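(* Let $\mathcal I\subset\mathcal F\{y_1,\ldots,y_n\}$ be a prime differential ideal of differential dimension $d$, and let $\mathcal A=\{A_1,\ldots,A_{n-d}\}$ be a characteristic set of $\mathcal I$ with respect to an arbitrary fixed ranking $\mathscr R$. Then $$\mathrm{ord}(\mathcal I)\le \mathrm{Jac}(\mathcal A),$$ where $\mathrm{Jac}(\mathcal A)$ is the Jacobi number of $\mathcal A$.
   Context: $\mathcal F$ is an ordinary differential field of characteristic zero with derivation $\delta$; $a^{(k)}=\delta^k a$. $\mathbb Y=\{y_1,\ldots,y_n\}$ are differential indeterminates and $\mathcal F\{\mathbb Y\}=\mathcal F[y_j^{(k)}:1\le j\le n,\ k\ge 0]$ is the differential polynomial ring. Prime differential ideals are assumed not to be the unit ideal. For $f\in\mathcal F\{\mathbb Y\}$, $\mathrm{ord}(f,y_i)$ is the greatest $k$ such that $y_i^{(k)}$ appears effectively in $f$, and $-\infty$ if no derivative of $y_i$ (including $y_i$) appears. A ranking is a total order on the derivatives $\Theta(\mathbb Y)=\{y_j^{(k)}\}$ with $\delta\alpha>\alpha$ and $\alpha_1>\alpha_2\Rightarrow\delta\alpha_1>\delta\alpha_2$. The leader $\mathrm{ld}(f)$ is the greatest derivative appearing effectively in $f$. $f$ is reduced w.r.t. $g$ if no proper derivative of $\mathrm{ld}(g)$ appears in $f$ and $\deg(f,\mathrm{ld}(g))<\deg(g,\mathrm{ld}(g))$. A set is auto-reduced if each element is reduced w.r.t. every other element. An auto-reduced set $\mathcal C\subset\mathcal J$ is a characteristic set of a differential ideal $\mathcal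 J$ if $\mathcal J$ contains no nonzero element reduced w.r.t. all elements of $\mathcal C$. Let $\eta=(\eta_1,\ldots,\eta_n)$ be a generic point of $\mathcal I$ (so $f(\eta)=0\Leftrightarrow f\in\mathcal I$). The differential dimension $d$ of $\mathcal I$ is the differential transcendence degree of $\mathcal F\langle\eta\rangle$ over $\mathcal F$; every characteristic set of $\mathcal I$ has $n-d$ elements. For all large $t$, the transcendence degree of $\mathcal F(\eta_i^{(j)}:1\le i\le n, j\le t)$ over $\mathcal F$ equals $d(t+1)+h$ for a unique integer $h\ge 0$; this $h$ is the order $\mathrm{ord}(\mathcal I)$. The Jacobi number of $\mathcal A=\{A_1,\ldots,A_{n-d}\}$ is $\mathrm{Jac}(\mathcal A)=\max_\sigma\sum_{i=1}^{n-d}\mathrm{ord}(A_i,y_{\sigma(i)})$, the maximum being over all injective maps $\sigma:\{1,\ldots,n-d\}\to\{1,\ldots,n\}$. *)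

(* Defs.v *)
(* {malg R[{cmonom V}]} is the polynomial ring over R in the (possibly infinitely
   many) indeterminates V; orders, which may be -oo, are taken in \bar int. *)
From HB Require Import structures.
From mathcomp Require Export all_boot all_order all_algebra finmap.
From mathcomp Require Export monalg.
From mathcomp Require Export constructive_ereal.
Export Order.TTheory GRing.Theory Num.Theory.

Set Implicit Arguments.
Unset Strict Implicit.
Unset Printing Implicit Defensive.

Local Open Scope ring_scope.

Definition derivation (R : comNzRingType) (D : R -> R) : Prop :=
  (forall a b, D (a + b) = D a + D b) /\
  (forall a b, D (a * b) = D a * b + a * D b).

(* The pair (j, k) stands for the derivative y_j^(k). *)
Notation theta n := ('I_n * nat)%type.

Notation dpoly F n := {malg F[{cmonom (theta n)}]}.

Definition dtheta (n : nat) (k : nat) (v : theta n) : theta n :=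
  (v.1, (k + v.2)%N).

Section DifferentialPolynomials.
Variables (F : fieldType) (n : nat).
Implicit Types (f g : dpoly F n) (v u : theta n) (i : 'I_n).

(* The derivation extending delta with y_j^(k) |-> y_j^(k+1), by the product
   rule on monomials: a m |-> delta(a) m + a * sum_v m(v) (m / v) (v'). *)
Definition dpoly_deriv (delta : F -> F) f : dpoly F n :=
  \sum_(m <- msupp f)
    (<< delta f@_m *g m >> +
     \sum_(v <- finsupp m)
       << f@_m *+ m v *g mmul (divcm m (ucm v)) (ucm (dtheta 1 v)) >>).

(* Subsets are boolean predicates; idealr_closed includes 1 \notin I. *)
Definition prime_diff_ideal (delta : F -> F) (I : {pred dpoly F n}) : Prop :=
  [/\ idealr_closed I, prime_idealr_closed I
    & {in I, forall f, dpoly_deriv delta f \in I}].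

Definition appears f v : bool :=
  has (fun m : {cmonom (theta n)} => v \in finsupp m) (msupp f).

Definition deg_in f v : nat := (\max_(m <- msupp f) (m : {cmonom (theta n)}) v)%N.

Definition dord f i : \bar int :=
  \big[Order.max/-oo%E]_(m <- msupp f)
    \big[Order.max/-oo%E]_(v <- finsupp m | v.1 == i) (v.2%:Z)%:E.

(* The strict order of a ranking. *)
Definition ranking (lt : rel (theta n)) : Prop :=
  [/\ irreflexive lt, transitive lt,
      forall u v, u != v -> lt u v || lt v u,
      forall v, lt v (dtheta 1 v)
    & forall u v, lt u v -> lt (dtheta 1 u) (dtheta 1 v)].

Definition is_leader (lt : rel (theta n)) f u : Prop :=
  appears f u /\ forall v, appears f v -> v != u -> lt v u.

Definition reduced (lt : rel (theta n)) f g : Prop :=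
  exists2 u, is_leader lt g u &
    (forall k, (0 < k)%N -> ~~ appears f (dtheta k u)) /\
    (deg_in f u < deg_in g u)%N.

(* Elements of an auto-reduced set are required to have a leader, i.e. to lie
   outside F.  The set is given as a family; auto-reducedness makes the family
   injective, since no element is reduced with respect to itself. *)
Definition autoreduced (lt : rel (theta n)) (m : nat) (A : 'I_m -> dpoly F n)
    : Prop :=
  (forall i : 'I_m, exists u, is_leader lt (A i) u) /\
  (forall i j : 'I_m, i != j -> reduced lt (A i) (A j)).

Definition characteristic_set (lt : rel (theta n)) (I : {pred dpoly F n})
    (m : nat) (A : 'I_m -> dpoly F n) : Prop :=
  [/\ autoreduced lt A, forall i : 'I_m, A i \in I
    & forall f, f \in I -> (forall i : 'I_m, reduced lt f (A i)) -> f = 0].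

Definition Jac (m : nat) (A : 'I_m -> dpoly F n) : \bar int :=
  \big[Order.max/-oo%E]_(s : {ffun 'I_m -> 'I_n} | injectiveb s)
    (\sum_(i < m) dord (A i) (s i))%E.

End DifferentialPolynomials.

Section Extensions.
Variables (F E : fieldType) (phi : {rmorphism F -> E}).
Implicit Types (K : E -> Prop) (dE : E -> E).

Definition diff_extension (delta : F -> F) dE : Prop :=
  derivation dE /\ forall a, dE (phi a) = phi (delta a).

Definition poly_eval (V : choiceType) (x : V -> E) (f : {malg F[{cmonom V}]})
    : E :=
  mmap phi (fun m : {cmonom V} => \prod_(v <- finsupp m) x v ^+ m v) f.

Definition dpoly_eval dE (n : nat) (eta : 'I_n -> E) (f : dpoly F n) : E :=
  poly_eval (fun v : theta n => iter v.2 dE (eta v.1)) f.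

Definition generic_point dE (n : nat) (I : {pred dpoly F n}) (eta : 'I_n -> E)
    : Prop :=
  forall f, dpoly_eval dE eta f = 0 <-> f \in I.

Definition alg_independent (m : nat) (a : 'I_m -> E) : Prop :=
  forall p : {malg F[{cmonom 'I_m}]}, poly_eval a p = 0 -> p = 0.

Definition diff_independent dE (m : nat) (a : 'I_m -> E) : Prop :=
  forall p : dpoly F m, dpoly_eval dE a p = 0 -> p = 0.

(* r is the largest size of an independent family in K, so that there is no
   such r when the transcendence degree is infinite. *)
Definition is_max_size (indep : forall m, ('I_m -> E) -> Prop) K (r : nat)
    : Prop :=
  (exists2 a : 'I_r -> E, (forall i, K (a i)) & indep r a) /\
  (forall m (a : 'I_m -> E), (forall i, K (a i)) -> indep m a -> (m <= r)%N).

Definition has_trdeg K (r : nat) : Prop := is_max_size alg_independent K r.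

Definition has_diff_trdeg dE K (r : nat) : Prop :=
  is_max_size (diff_independent dE) K r.

Definition intermediate_field (L : {pred E}) : Prop :=
  divring_closed L /\ forall a, phi a \in L.

Definition adjoin (S : E -> Prop) : E -> Prop := fun x =>
  forall L : {pred E}, intermediate_field L ->
    (forall y, S y -> y \in L) -> x \in L.

Definition diff_adjoin dE (n : nat) (eta : 'I_n -> E) : E -> Prop := fun x =>
  forall L : {pred E}, intermediate_field L -> {in L, forall y, dE y \in L} ->
    (forall i, eta i \in L) -> x \in L.

Definition derivatives_upto dE (n : nat) (eta : 'I_n -> E) (t : nat)
    : E -> Prop :=
  fun x => exists i j, (j <= t)%N /\ x = iter j dE (eta i).

(* The differential dimension and the order of an ideal, read off from a
   generic point eta. *)
Definition diff_dim dE (n : nat) (eta : 'I_n -> E) (d : nat) : Prop :=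
  has_diff_trdeg dE (diff_adjoin dE eta) d.

Definition diff_order dE (n : nat) (eta : 'I_n -> E) (d h : nat) : Prop :=
  exists t0, forall t, (t0 <= t)%N ->
    has_trdeg (adjoin (derivatives_upto dE eta t)) (d * t.+1 + h).

End Extensions.

(* Main.v *)
From HB Require Import structures.
Require Import Defs.
From mathcomp Require Import boolp zify ring.

Set Implicit Arguments.
Unset Strict Implicit.
Unset Printing Implicit Defensive.

Local Open Scope ring_scope.

(** The elements A_i of the characteristic set and their derivatives give
    relations A_i^(k)(eta) = 0, for k < M_i, between the derivatives of the
    generic point eta; if

      ord(A_i, y_j) + M_i <= N_j   whenever y_j occurs in A_i,      (1)

    these relations only involve the window of derivatives y_j^(k), k < N_j.
    The leaders of the A_i^(k), k < M_i, are pairwise distinct, and each of them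
    takes at eta a value that is algebraic over the values of smaller
    derivatives in the window: A_i^(k) vanishes at eta, and its partial
    derivative with respect to its leader is the separant of A_i, for every k.  The separant is nonzero because the characteristic is zero, and
    it is reduced with respect to the characteristic set, hence not in I.
    Induction along the ranking shows that the values of the window are all
    algebraic over those of the sum N_j - sum M_i derivatives that are not
    leaders ([window_algebraic]), so

      trdeg F(y_j^(k)(eta) : k < N_j) <= sum_j N_j - sum_i M_i.     (2)

    The right choice of M and N is an optimal dual solution of the assignment
    problem that defines the Jacobi number: [assignment_duality] gives M and N
    satisfying (1), with all N_j at least some T as large as needed, such that

      sum_j N_j <= sum_i M_i + Jac(A) + d T.

    As the left side of (2) is at least d T + ord(I), this is the theorem.

    Two standard tools are built on the way: the matching theorem of Hall, from
    which the duality follows ([hall_matching], [tight_potential]), and the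
    exchange argument for algebraic dependence ([exchange], [steinitz]), which
    turns the algebraicity statement into the bound (2) ([independent_leq]). *)

(** * Matchings and duality for the assignment problem *)

Section Matching.
Local Open Scope nat_scope.

Definition hall (T C : finType) (G : T -> {set C}) :=
  forall X : {set T}, #|X| <= #|\bigcup_(x in X) G x|.

(** If both deletions violated the condition, at X1 and X2 say, both sets would
    contain x, and submodularity of the cardinality, applied to X1 :|: X2 and
    to X1 :&: X2 without x, would contradict the condition for G. *)
Lemma hall_shrink (T C : finType) (G : T -> {set C}) (x : T) (y1 y2 : C) :
  let G' y z := if z == x then G x :\ y else G z in
  hall G -> y1 != y2 -> hall (G' y1) \/ hall (G' y2).
Proof.
move=> G' hG y12; have [h1|n1] := pselect (hall (G' y1)); first by left.
right => X2; rewrite leqNgt; apply/negP => lt2.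
case: n1 => X1; rewrite leqNgt; apply/negP => lt1.
have xin y (X : {set T}) : #|\bigcup_(z in X) G' y z| < #|X| -> x \in X.
  move=> ltX; apply: contraTT ltX => xX; rewrite -leqNgt.
  rewrite (eq_bigr G); first exact: hG.
  by move=> z zX; rewrite /G' ifN //; apply: contraNneq xX => <-.
have x1 := xin _ _ lt1; have x2 := xin _ _ lt2.
set N1 := \bigcup_(z in X1) _ in lt1; set N2 := \bigcup_(z in X2) _ in lt2.
have hU : \bigcup_(z in X1 :|: X2) G z \subset N1 :|: N2.
  apply/bigcupsP => z zX; apply/subsetP => c cz; rewrite inE.
  have [ezx|nzx] := eqVneq z x.
    have [ec|nc] := eqVneq c y1.
      apply/orP; right; apply/bigcupP; exists x => //.
      by rewrite /G' eqxx !inE -ezx cz ec y12.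
    apply/orP; left; apply/bigcupP; exists x => //.
    by rewrite /G' eqxx !inE -ezx cz nc.
  move: zX; rewrite inE => /orP[] zX; apply/orP; [left|right];
    by apply/bigcupP; exists z => //; rewrite /G' (negPf nzx).
have hI : \bigcup_(z in (X1 :&: X2) :\ x) G z \subset N1 :&: N2.
  apply/bigcupsP => z; rewrite !inE => /and3P[nzx z1 z2].
  apply/subsetP => c cz; rewrite inE; apply/andP.
  by split; apply/bigcupP; exists z => //; rewrite /G' (negPf nzx).
have := leq_trans (hG _) (subset_leq_card hU).
have := leq_trans (hG _) (subset_leq_card hI).
have := cardsUI X1 X2; have := cardsUI N1 N2.
have := cardsD1 x (X1 :&: X2); rewrite inE x1 x2 /=.
lia.
Qed.

(** Delete candidates one at a time, preserving the condition, until each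
    element has a single candidate left; the condition on pairs then says that
    distinct elements have distinct candidates. *)
Lemma hall_matching (T C : finType) (G : T -> {set C}) : hall G ->
  exists2 f : T -> C, injective f & forall x, f x \in G x.
Proof.
have [k] := ubnP (\sum_x #|G x|); elim: k G => // k IH G ltk hG.
have shrink x y (G' := fun z => if z == x then G x :\ y else G z) :
    y \in G x -> hall G' ->
    exists2 f : T -> C, injective f & forall z, f z \in G z.
  move=> yx hG'; have [|f injf fG] := IH _ _ hG'.
    rewrite -ltnS; apply: leq_trans ltk; rewrite ltnS.
    rewrite (bigD1 x) //= [X in _ < X](bigD1 x) //= /G' eqxx.
    rewrite (cardsD1 y (G x)) yx /= add1n addSn ltnS leq_add2l.
    by apply: leq_sum => z /negPf ->.
  exists f => // z; have := fG z; rewrite /G'; case: eqP => // ->.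
  by rewrite inE => /andP[].
have [[x [y1 [y2 [y1x y2x y12]]]]|one] :=
  pselect (exists x y1 y2, [/\ y1 \in G x, y2 \in G x & y1 != y2]).
  case: (hall_shrink x hG y12) => hG'.
    exact: shrink y1x hG'.
  exact: shrink y2x hG'.
have ne x : exists c, c \in G x.
  apply/set0Pn; rewrite -card_gt0; have := hG [set x].
  by rewrite cards1 big_set1.
have [f fG] := choice ne; exists f => // x y efxy; apply/eqP/negPn/negP => nxy.
have := hG [set x; y]; rewrite cards2 nxy /= leqNgt => /negP; apply.
rewrite ltnS -(cards1 (f x)); apply: subset_leq_card; apply/bigcupsP => z zxy.
apply/subsetP => c cz; rewrite inE; apply/negPn/negP => nc; case: one.
exists z, c, (f x); split=> //.
by move: zxy; rewrite !inE => /orP[] /eqP ->; rewrite // efxy.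
Qed.

(** Dual feasibility, with N - M in place of a sum of multipliers, so that both
    are naturals and an improvement of the dual only increases them. *)
Definition potential (R C : finType) (e : R -> C -> bool) (c : R -> C -> nat)
    (M : R -> nat) (N : C -> nat) :=
  forall r j, e r j -> c r j + M r <= N j.

(** As long as the tight pairs admit no perfect matching, Hall's condition fails
    at some set X of rows; raising M on X and N on the tight neighbours of X
    keeps feasibility and lowers sum N - sum M, which weak duality against the
    matching [s0] bounds from below. *)
Lemma tight_potential (R C : finType) (e : R -> C -> bool) (c : R -> C -> nat)
    (s0 : R -> C) (M : R -> nat) (N : C -> nat) :
  injective s0 -> #|R| = #|C| -> (forall r, e r (s0 r)) -> potential e c M N ->
  exists M' N' (s : R -> C),
    [/\ forall r, M r <= M' r, forall j, N j <= N' j, potential e c M' N',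
        injective s & forall r, e r (s r) /\ c r (s r) + M' r = N' (s r)].
Proof.
move=> inj0 RC es0.
have [k] := ubnP (\sum_j N j - \sum_r M r); elim: k M N => // k IH M N ltk pMN.
pose G r := [set j | e r j && (c r j + M r == N j)].
have [hG|/asboolPn] := pselect (hall G).
  have [s injs sG] := hall_matching hG; exists M, N, s; split=> // r.
  by have := sG r; rewrite inE => /andP[er /eqP].
move=> /asboolPn/existsNP[X /negP]; rewrite -ltnNge => ltX.
pose M' r := M r + (r \in X); pose N' j := N j + (j \in \bigcup_(x in X) G x).
have pMN' : potential e c M' N'.
  move=> r j er; have := pMN r j er; rewrite /M' /N'.
  case: (boolP (r \in X)) => rX; last by lia.
  case: (boolP (j \in _)) => jX; first by lia.
  rewrite leq_eqVlt => /orP[/eqP ecN|]; last by lia.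
  by case/negP: jX; apply/bigcupP; exists r; rewrite // inE er ecN eqxx.
have le_sum P Q : potential e c P Q -> \sum_r P r <= \sum_j Q j.
  move=> pPQ; have [t s0t ts0] : bijective s0 by apply: inj_card_bij; rewrite ?RC.
  rewrite (reindex s0) /=; last by exists t => ? _.
  by apply: leq_sum => r _; have := pPQ r _ (es0 r); lia.
have cardE (T : finType) (A : {set T}) : \sum_x (x \in A : nat) = #|A|.
  by rewrite -sum1_card [RHS]big_mkcond /=; apply: eq_bigr => x _; case: ifP.
have [|M1 [N1 [s [leM leN pMN1 injs sG]]]] := IH M' N' _ pMN'.
  have := le_sum _ _ pMN'; rewrite /M' /N' !big_split /= !cardE.
  have := le_sum _ _ pMN; lia.
exists M1, N1, s; split=> // [r|j].
  by apply: leq_trans (leM r); rewrite leq_addr.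
by apply: leq_trans (leN j); rewrite leq_addr.
Qed.

Lemma extend_injection m n (s : 'I_m -> 'I_n) : injective s ->
  exists2 s' : 'I_m + 'I_(n - m) -> 'I_n, injective s' &
    forall i, s' (inl i) = s i.
Proof.
move=> injs; pose A := ~: [set s i | i : 'I_m].
have cA : n - m = #|A| by rewrite cardsCs setCK card_imset // !card_ord.
exists (fun x => match x with
  | inl i => s i | inr j => enum_val (cast_ord cA j) end) => //.
have dis i j : s i <> enum_val (cast_ord cA j).
  move=> eij; have := enum_valP (cast_ord cA j); rewrite -eij inE.
  by rewrite imset_f.
move=> [i|i] [j|j] /=; [by move=> /injs-> | by move/dis | by move/esym/dis |].
by move=> /enum_val_inj/cast_ord_inj->.
Qed.

(** The square case applies after adding n - m rows of zeros, where everything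
    is allowed.  T is the largest of T0 and of the potentials of the added rows:
    these potentials bound every N_j from below, since the entries of the added
    rows are zero, and they contribute the term (n - m) * T. *)
Lemma assignment_duality m n (e : 'I_m -> 'I_n -> bool) (c : 'I_m -> 'I_n -> nat)
    (s0 : 'I_m -> 'I_n) (T0 : nat) :
  injective s0 -> (forall i, e i (s0 i)) ->
  exists T M N (s : 'I_m -> 'I_n),
    [/\ T0 <= T, forall j, T <= N j, potential e c M N,
        injective s /\ (forall i, e i (s i)) &
        \sum_j N j <= \sum_i M i + \sum_i c i (s i) + (n - m) * T].
Proof.
move=> inj0 es0; have [s1 inj1 s10] := extend_injection inj0.
have lemn : m <= n by have := leq_card s0 inj0; rewrite !card_ord.
pose e1 (x : 'I_m + 'I_(n - m)) j := if x is inl i then e i j else true.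
pose c1 (x : 'I_m + 'I_(n - m)) j := if x is inl i then c i j else 0.
have cRC : #|{: 'I_m + 'I_(n - m)}| = #|'I_n|.
  by rewrite card_sum !card_ord subnKC.
pose B := \max_i \max_j c i j.
have [||M [N [s [leM leN pMN injs es]]]] :=
  @tight_potential _ _ e1 c1 s1 (fun=> T0) (fun=> B + T0) inj1 cRC.
- by case=> i //=; rewrite s10.
- case=> i j _ //=; rewrite ?leq_add2r ?leq_add2l // /c1 ?leq_addl //.
  exact: leq_trans (leq_bigmax j) (leq_bigmax i).
have [t st ts] : bijective s by apply: inj_card_bij => //; rewrite cRC.
pose T := maxn T0 (\max_k M (inr k)).
exists T, (fun i => M (inl i)), N, (fun i => s (inl i)); split.
- exact: leq_maxl.
- move=> j; rewrite geq_max (leq_trans _ (leN j)) ?leq_addl //=.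
  by apply/bigmax_leqP => k _; apply: (pMN (inr k)).
- by move=> i j eij; apply: (pMN (inl i)).
- split=> [i j /injs[] //|i]; exact: (es (inl i)).1.
rewrite (reindex s) /=; last by exists t => ? _.
under eq_bigr => r _ do rewrite -(es r).2.
rewrite big_sumType /= big_split /= [X in X + _]addnC leq_add2l.
rewrite -[n - m as X in X * T]card_ord -sum_nat_const; apply: leq_sum => k _.
by rewrite add0n leq_max (leq_bigmax k) orbT.
Qed.

End Matching.

(** * Algebraic dependence in a field *)

Section Subfield.
Variables (E : fieldType) (S : divringClosed E).
(** Gives a divring-closed predicate the structure of a field, so that the
    theory of algebraic elements over a field morphism applies to it. *)
Record subfield_of := Subfield {subfield_val : E; _ : subfield_val \in S}.
HB.instance Definition _ := [isSub for subfield_val].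
HB.instance Definition _ := [Choice of subfield_of by <:].
HB.instance Definition _ := [SubChoice_isSubIntegralDomain of subfield_of by <:].
HB.instance Definition _ := [SubIntegralDomain_isSubField of subfield_of by <:].
End Subfield.

Section AlgebraicClosure.
Variable E : fieldType.
Implicit Types (R L : {pred E}) (p q : {poly E}).

Definition alg_over R : {pred E} := fun x =>
  `[< exists p, [/\ forall i, p`_i \in R, p != 0 & root p x] >].

Definition rel_alg_closed L := divring_closed L /\ {subset alg_over L <= L}.

Lemma alg_overP R x :
  reflect (exists p, [/\ forall i, p`_i \in R, p != 0 & root p x])
          (x \in alg_over R).
Proof. exact: asboolP. Qed.

Lemma alg_overS R1 R2 : {subset R1 <= R2} ->
  {subset alg_over R1 <= alg_over R2}.
Proof.
move=> sR x /alg_overP[p [Rp p0 px]]; apply/alg_overP; exists p; split=> // i.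
exact/sR/Rp.
Qed.

Lemma sub_alg_over R : subring_closed R -> {subset R <= alg_over R}.
Proof.
move=> hR x xR; apply/alg_overP; exists ('X - x%:P).
pose S : subringClosed E := HB.pack R (GRing.isSubringClosed.Build E R hR).
rewrite polyXsubC_eq0 root_XsubC eqxx; split=> //.
by apply/(@polyOverP _ S); rewrite (polyOverXsubC S).
Qed.

(** Algebraic elements over a field form a field, and a root of a polynomial
    with algebraic coefficients is algebraic. *)
Lemma alg_over_divring L : divring_closed L -> rel_alg_closed (alg_over L).
Proof.
move=> hL.
pose S : divringClosed E := HB.pack L (GRing.isDivringClosed.Build E L hL).
pose iota := GRing.RMorphism.clone _ _ (\val : subfield_of S -> E) _.
have algE x : x \in alg_over L <-> algebraicOver iota x.
  split=> [/alg_overP[p [Lp p0 px]]|[p p0 px]]; last first.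
    apply/alg_overP; exists (map_poly iota p); rewrite map_poly_eq0.
    by split=> // i; rewrite coef_map; apply: (valP p`_i).
  have [q qp] : exists q : {poly subfield_of S}, map_poly iota q = p.
    exists (\poly_(i < size p) insubd (0 : subfield_of S) p`_i).
    apply/polyP => i; rewrite coef_map coef_poly; case: ltnP => [_|le].
      exact: (insubdK (0 : subfield_of S) (Lp i)).
    by rewrite [LHS](rmorph0 iota) nth_default.
  by exists q; rewrite ?qp // -(map_poly_eq0 iota) qp.
split; first split.
- apply/algE; exact: algebraic1.
- move=> x y /algE ax /algE ay; apply/algE; exact: algebraic_sub.
- move=> x y /algE ax /algE ay; apply/algE; exact: algebraic_div.
move=> x /alg_overP[p [Lp p0 px]]; apply/algE/integral_algebraic.
apply: integral_root p0 px _; apply/integral_poly => i.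
by apply/integral_algebraic/algE/Lp.
Qed.

(** Clearing denominators, being algebraic over R is the same as being algebraic
    over the fraction field of R. *)
Lemma alg_over_subring R : subring_closed R -> rel_alg_closed (alg_over R).
Proof.
move=> hR.
pose S : subringClosed E := HB.pack R (GRing.isSubringClosed.Build E R hR).
(* the fraction field of R *)
pose K : {pred E} := fun x =>
  `[< exists a b, [/\ a \in S, b \in S, b != 0 & x = a / b] >].
have KP x : reflect (exists a b, [/\ a \in S, b \in S, b != 0 & x = a / b])
    (x \in K) by exact: asboolP.
have hK : divring_closed K.
  split.
  - by apply/KP; exists 1, 1; rewrite rpred1 oner_neq0 divr1.
  - move=> _ _ /KP[a [b [aS bS b0 ->]]] /KP[c [d [cS dS d0 ->]]].
    apply/KP; exists (a * d - c * b), (b * d).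
    rewrite rpredB ?rpredM // mulf_neq0 //; split=> //; field.
    by rewrite b0 d0.
  - move=> _ _ /KP[a [b [aS bS b0 ->]]] /KP[c [d [cS dS d0 ->]]].
    have [->|c0] := eqVneq c 0.
      by apply/KP; exists 0, 1;
      rewrite mul0r invr0 mulr0 mul0r rpred0 rpred1 oner_neq0.
    by apply/KP; exists (a * d), (b * c);
      rewrite !rpredM ?mulf_neq0 // invf_div mulf_div.
have sK : {subset S <= K}.
  by move=> a aS; apply/KP; exists a, 1; rewrite aS rpred1 oner_neq0 divr1.
pose KS : divringClosed E := HB.pack K (GRing.isDivringClosed.Build E K hK).
have clear p : p \is a polyOver KS ->
    exists2 b, b != 0 & b *: p \is a polyOver S /\ b \in S.
  elim/poly_ind: p => [_|p c IH].
    by exists 1; rewrite ?oner_neq0 // scaler0 rpred0 rpred1.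
  move=> Kp; have Kc : c \in K.
    by move/(@polyOverP _ KS)/(_ 0%N): Kp; rewrite coefD coefMX coefC add0r.
  have [|b b0 [Sp Sb]] := IH.
    apply/polyOverP => i; move/polyOverP/(_ i.+1): Kp.
    by rewrite coefD coefMX coefC addr0.
  have [a [d [aS dS d0 ->]]] := KP _ Kc; exists (d * b); rewrite ?mulf_neq0 //.
  split; last exact: rpredM.
  have -> : (d * b) *: (p * 'X + (a / d)%:P) = (d *: (b *: p)) * 'X + (a * b)%:P.
    rewrite scalerDr scalerA -scalerAl -[_ *: _%:P]mul_polyC -polyCM.
    by congr (_ + _%:P); field.
  apply: rpredD; last by rewrite polyOverC rpredM.
  by apply: rpredM; [apply: polyOverZ|apply: polyOverX].
have algK : alg_over R =i alg_over K.
  move=> x; apply/idP/idP; first exact: alg_overS.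
  case/alg_overP => p [/(@polyOverP _ KS)/clear[b b0 [/polyOverP Sp _]] p0 px].
  by apply/alg_overP; exists (b *: p); rewrite scaler_eq0 negb_or b0 p0 rootZ.
have [[h1 hB hV] hcl] := alg_over_divring hK.
split; [split|].
- by rewrite algK.
- by move=> x y; rewrite !algK; apply: hB.
- by move=> x y; rewrite !algK; apply: hV.
by move=> x xR; rewrite algK; apply: hcl; apply: alg_overS xR => y; rewrite algK.
Qed.

(** The algebraic closure in E of the field generated by L and b, as an
    intersection: being extensive, monotone and idempotent is then immediate,
    and only the exchange property needs explicit polynomials. *)
Definition adjoin_closed L (b : seq E) : {pred E} := fun x =>
  `[< forall M, rel_alg_closed M -> {subset L <= M} -> {subset b <= M} ->
      x \in M >].

Lemma adjoin_closedP L b x :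
  reflect (forall M, rel_alg_closed M -> {subset L <= M} -> {subset b <= M} ->
             x \in M) (x \in adjoin_closed L b).
Proof. exact: asboolP. Qed.

Lemma adjoin_closed_closed L b : rel_alg_closed (adjoin_closed L b).
Proof.
split; first split.
- by apply/adjoin_closedP => M [[]].
- move=> x y /adjoin_closedP hx /adjoin_closedP hy.
  apply/adjoin_closedP => M hM LM bM; have [[_ hB _] _] := hM.
  by apply: hB; [apply: hx|apply: hy].
- move=> x y /adjoin_closedP hx /adjoin_closedP hy.
  apply/adjoin_closedP => M hM LM bM; have [[_ _ hV] _] := hM.
  by apply: hV; [apply: hx|apply: hy].
move=> x xa; apply/adjoin_closedP => M hM LM bM.
apply: hM.2; apply: alg_overS xa => y /adjoin_closedP hy; exact: hy _ hM LM bM.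
Qed.

Lemma sub_adjoin_closed L b : {subset L <= adjoin_closed L b}.
Proof. by move=> x xL; apply/adjoin_closedP => M _ sM _; exact: sM. Qed.

Lemma mem_adjoin_closed L b : {subset b <= adjoin_closed L b}.
Proof. by move=> x xL; apply/adjoin_closedP => M _ _ sM; exact: sM. Qed.

(** The element x is a root of a nonzero polynomial over L[y], that is,
    u(x, y) = 0 for some bivariate u over L.  Read as a polynomial in y over
    L(x), u(x, -) is nonzero: one of its coefficients is the value at x of a
    nonzero polynomial over L, and x is transcendental over L. *)
Lemma exchange L x y : rel_alg_closed L ->
  x \in adjoin_closed L [:: y] -> x \notin L -> y \in adjoin_closed L [:: x].
Proof.
move=> hL xy xL; have [hdL algL] := hL.
pose S : divringClosed E := HB.pack L (GRing.isDivringClosed.Build E L hdL).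
pose R : {pred E} := fun z => `[< exists2 p, p \is a polyOver S & z = p.[y] >].
have RP z : reflect (exists2 p, p \is a polyOver S & z = p.[y])
    (z \in R) by exact: asboolP.
have hR : subring_closed R.
  split.
  - by apply/RP; exists 1; rewrite ?rpred1 // hornerC.
  - move=> _ _ /RP[p Sp ->] /RP[q Sq ->]; apply/RP; exists (p - q);
      rewrite ?rpredB //.
    by rewrite hornerD hornerN.
  - move=> _ _ /RP[p Sp ->] /RP[q Sq ->]; apply/RP; exists (p * q);
      rewrite ?rpredM //.
    by rewrite hornerM.
have LR : {subset L <= R}.
  by move=> z zL; apply/RP; exists z%:P; rewrite ?polyOverC // hornerC.
have yR : y \in R by apply/RP; exists 'X; rewrite ?polyOverX // hornerX.
have sR := sub_alg_over hR.
have /alg_overP[q [Rq q0 qx]] : x \in alg_over R.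
  move/adjoin_closedP: xy; apply; first exact: alg_over_subring.
    by move=> z /LR/sR.
  by move=> z; rewrite inE => /eqP->; apply: sR.
have [P Pq] : exists P : nat -> {poly E},
    forall i, P i \is a polyOver S /\ q`_i = (P i).[y].
  have h i : exists p, p \is a polyOver S /\ q`_i = p.[y].
    by have /RP[p Sp ->] := Rq i; exists p.
  by have [P hP] := choice h; exists P.
pose u : {poly {poly E}} := \poly_(i < size q) P i.
have ux : u.[x%:P].[y] = 0.
  rewrite horner_poly horner_sum -[RHS](rootP qx) horner_coef; apply: eq_bigr => i _.
  by rewrite hornerM -polyC_exp hornerC (Pq i).2.
have hM := adjoin_closed_closed L [:: x].
pose M : divringClosed E := HB.pack (adjoin_closed L [:: x])
  (GRing.isDivringClosed.Build E _ hM.1).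
have LM : {subset L <= M} by exact: sub_adjoin_closed.
have xM : x \in M by apply: mem_adjoin_closed; rewrite inE.
apply: hM.2; apply/alg_overP; exists u.[x%:P]; split; last by apply/rootP.
  apply/(@polyOverP _ M).
  rewrite horner_poly; apply: rpred_sum => i _; apply: rpredM.
    exact: polyOverS LM _ (Pq i).1.
  by rewrite -polyC_exp polyOverC rpredX.
have [i qi] : exists i, q`_i != 0.
  by exists (size q).-1; rewrite -lead_coefE lead_coef_eq0.
have [j Pij] : exists j, (P i)`_j != 0.
  have Pi0 : P i != 0 by apply: contraNneq qi => Pi0; rewrite (Pq i).2 Pi0 hornerC.
  by exists (size (P i)).-1; rewrite -lead_coefE lead_coef_eq0.
(* the coefficient of Y^j in u(X, Y), evaluated below at x *)
pose w : {poly E} := \poly_(i < size q) (P i)`_j.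
have wE : (u.[x%:P])`_j = w.[x].
  rewrite !horner_poly coef_sum; apply: eq_bigr => k _.
  by rewrite -polyC_exp coefMC.
apply: contraNneq xL => ux0; apply: algL; apply/alg_overP; exists w; split.
- move=> k; rewrite coef_poly; case: ifP => _; last exact: (rpred0 S).
  exact: polyOverP (Pq k).1 j.
- apply: contraNneq Pij => w0; have := congr1 (fun p => p`_i) w0.
  rewrite coef_poly coef0; case: ltnP => [_ ->|le_qi] //.
  by move: qi; rewrite nth_default ?eqxx.
- by apply/rootP; rewrite -wE ux0 coef0.
Qed.

(** Independence in its sequential form, the one consumed by the exchange
    argument. *)
Fixpoint free_over L (a : seq E) : Prop :=
  if a is x :: a' then x \notin L /\ free_over (adjoin_closed L [:: x]) a'
  else True.

Lemma first_dependence L b x : rel_alg_closed L ->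
  x \in adjoin_closed L b -> x \notin L ->
  exists b1 y b2, [/\ b = b1 ++ y :: b2, x \notin adjoin_closed L b1 &
    x \in adjoin_closed (adjoin_closed L b1) [:: y]].
Proof.
move=> hL; elim/last_ind: b => [|b y IH] xb xL.
  by case/negP: xL; move/adjoin_closedP: xb; apply.
have [{}xb'|nxb] := boolP (x \in adjoin_closed L b).
  have [b1 [z [b2 [-> h1 h2]]]] := IH xb' xL.
  by exists b1, z, (rcons b2 y); rewrite rcons_cat.
exists b, y, [::]; rewrite -cats1; split=> //.
apply/adjoin_closedP => M hM LM yM; move/adjoin_closedP: xb; apply=> // z.
  by move=> zL; apply/LM/sub_adjoin_closed.
rewrite mem_rcons inE => /orP[zy|zb]; first by apply: yM; rewrite inE.
by apply/LM/mem_adjoin_closed.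
Qed.

(** The first element x of a depends on b, and not on the empty sequence, so
    some y in b can be exchanged for x; the rest of a is then independent over
    the closure of L(x), and depends on b without y. *)
Lemma steinitz L (a b : seq E) : rel_alg_closed L ->
  free_over L a -> {subset a <= adjoin_closed L b} -> (size a <= size b)%N.
Proof.
elim: a L b => // x a IH L b hL [xL fra] sab.
have xb : x \in adjoin_closed L b by apply: sab; rewrite inE eqxx.
have [b1 [y [b2 [eb xb1 xy]]]] := first_dependence hL xb xL.
have yx := exchange (adjoin_closed_closed L b1) xy xb1.
have -> : size b = (size (b1 ++ b2)).+1 by rewrite eb !size_cat addnS.
rewrite ltnS; apply: IH (adjoin_closed_closed L [:: x]) fra _ => z za.
apply/adjoin_closedP => M hM LM bM.
have LM' : {subset L <= M} by move=> w wL; apply/LM/sub_adjoin_closed.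
have xM : {subset [:: x] <= M} by move=> w wx; apply/LM/mem_adjoin_closed.
have b1M w : w \in b1 -> w \in M by move=> wb; apply: bM; rewrite mem_cat wb.
have yM : y \in M.
  move/adjoin_closedP: yx; apply=> // w /adjoin_closedP hw; exact: hw.
have /adjoin_closedP : z \in adjoin_closed L b by apply: sab; rewrite inE za orbT.
apply=> // w; rewrite eb mem_cat inE => /or3P[|/eqP->|wb2] //; first exact: b1M.
by apply: bM; rewrite mem_cat wb2 orbT.
Qed.

End AlgebraicClosure.

(** * Algebraically independent families *)

Section Evaluation.
Variables (F E : fieldType) (phi : {rmorphism F -> E}) (V : choiceType).
Variable (x : V -> E).
Implicit Types (f g : {malg F[{cmonom V}]}) (m : {cmonom V}).

Definition cmonom_eval m : E := \prod_(v <- finsupp m) x v ^+ m v.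

Lemma cmonom_evalEw (d : {fset V}) m : (finsupp m `<=` d)%fset ->
  cmonom_eval m = \prod_(v <- d) x v ^+ m v.
Proof.
move=> le; apply: big_fset_incl le _ => v _; rewrite -cmE_eq0 => /eqP->.
by rewrite expr0.
Qed.

Lemma cmonom_eval_mmorphism : mmorphism cmonom_eval.
Proof.
split=> [m1 m2|]; last by rewrite /cmonom_eval mdom1 big_seq_fset0.
rewrite (cmonom_evalEw (fsubsetUl (finsupp m1) (finsupp m2))).
rewrite (cmonom_evalEw (fsubsetUr (finsupp m1) (finsupp m2))) -big_split /=.
rewrite /cmonom_eval mdomD; apply: eq_bigr => v _; by rewrite cmM exprD.
Qed.

HB.instance Definition _ :=
  monalg.isMultiplicative.Build {cmonom V} E cmonom_eval cmonom_eval_mmorphism.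

HB.instance Definition _ :=
  GRing.RMorphism.copy (poly_eval phi x) (mmap phi cmonom_eval).

Lemma poly_evalU c m : poly_eval phi x << c *g m >> = phi c * cmonom_eval m.
Proof. exact: mmapU. Qed.

Lemma poly_evalE f :
  poly_eval phi x f = \sum_(m <- msupp f) phi f@_m * cmonom_eval m.
Proof. by []. Qed.

Lemma cmonom_evalU v : cmonom_eval (ucm v) = x v.
Proof. by rewrite /cmonom_eval mdomU big_seq_fset1 cmUU. Qed.

Definition powcm v i : {cmonom V} := iter i (mmul (ucm v)) mone.

Lemma powcmE v i w : powcm v i w = (i * (v == w))%N.
Proof. by elim: i => [|i IH]; rewrite /= ?cm1 // cmM cmU IH mulSn. Qed.

Lemma cmonom_eval_powcm v i : cmonom_eval (powcm v i) = x v ^+ i.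
Proof.
elim: i => [|i IH]; first exact: mmorph1.
by rewrite /= mmorphM /= cmonom_evalU IH exprS.
Qed.

Definition only_in (U : pred V) f :=
  forall m v, m \in msupp f -> v \in finsupp m -> U v.

Definition eval_range (U : pred V) : {pred E} := fun z =>
  `[< exists2 f, only_in U f & z = poly_eval phi x f >].

Lemma eval_rangeP (U : pred V) z :
  reflect (exists2 f, only_in U f & z = poly_eval phi x f) (z \in eval_range U).
Proof. exact: asboolP. Qed.

Lemma eval_range_const U c : phi c \in eval_range U.
Proof.
apply/eval_rangeP; exists c%:MP; last by rewrite poly_evalU mmorph1 mulr1.
by move=> m v /(fsubsetP (msuppC_le _)); rewrite inE => /eqP->; rewrite mdom1.
Qed.

Lemma eval_range_subring U : subring_closed (eval_range U).
Proof.
split.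
- by rewrite -(rmorph1 phi); apply: eval_range_const.
- move=> _ _ /eval_rangeP[f Uf ->] /eval_rangeP[g Ug ->]; apply/eval_rangeP.
  exists (f - g); last by rewrite rmorphB.
  move=> m v /(fsubsetP (msuppB_le f g)); rewrite inE => /orP[mf|mg] vm.
    exact: Uf mf vm.
  exact: Ug mg vm.
move=> _ _ /eval_rangeP[f Uf ->] /eval_rangeP[g Ug ->]; apply/eval_rangeP.
exists (f * g); last by rewrite rmorphM.
move=> m v /msuppM_le[m1 [m2 [m1f m2g ->]]]; rewrite mdomD inE => /orP[].
  exact: Uf.
exact: Ug.
Qed.

Lemma eval_range_var (U : pred V) v : U v -> x v \in eval_range U.
Proof.
move=> Uv; apply/eval_rangeP; exists << ucm v >>; last first.
  by rewrite poly_evalU rmorph1 mul1r cmonom_evalU.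
move=> m w /(fsubsetP msuppU_le); rewrite inE => /eqP->.
by rewrite mdomU inE => /eqP->.
Qed.

Lemma eval_rangeS (U1 U2 : pred V) : subpred U1 U2 ->
  {subset eval_range U1 <= eval_range U2}.
Proof.
move=> sU z /eval_rangeP[f Uf ->]; apply/eval_rangeP; exists f => // m v mf vm.
exact/sU/(Uf m).
Qed.

(** An algebraic equation of x v over the subring generated by the x u, u in U,
    lifts to the polynomial relation sum_i f_i v^i.  Since the f_i do not involve
    v, no two terms of this sum share a monomial, so a nonzero f_i makes it
    nonzero. *)
Lemma transcendental_over_range (U : pred V) v :
  (forall f, poly_eval phi x f = 0 -> f = 0) ->
  ~~ U v -> x v \notin alg_over (eval_range U).
Proof.
move=> ind nUv; apply/negP => /alg_overP[q [Rq q0 qx]].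
have [f hf] : exists f : nat -> {malg F[{cmonom V}]},
    forall i, only_in U (f i) /\ q`_i = poly_eval phi x (f i).
  have h i : exists g, only_in U g /\ q`_i = poly_eval phi x g.
    by have /eval_rangeP[g Ug ->] := Rq i; exists g.
  by have [f hf] := choice h; exists f.
pose P : {malg F[{cmonom V}]} := \sum_(i < size q) \sum_(m <- msupp (f i))
  << (f i)@_m *g mmul m (powcm v i) >>.
have P0 : P = 0.
  apply: ind; rewrite raddf_sum -[RHS](rootP qx) horner_coef.
  apply: eq_bigr => i _; rewrite raddf_sum (hf i).2 poly_evalE mulr_suml.
  apply: eq_bigr => m _; rewrite [LHS]poly_evalU mmorphM /= cmonom_eval_powcm.
  by rewrite mulrA.
have [i0 qi0] : exists i : 'I_(size q), q`_i != 0.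
  have sq : ((size q).-1 < size q)%N by rewrite prednK // size_poly_gt0.
  by exists (Ordinal sq); rewrite -lead_coefE lead_coef_eq0.
have /fset0Pn[m0 m0f] : msupp (f i0) != fset0.
  by rewrite msupp_eq0; apply: contraNneq qi0 => f0; rewrite (hf i0).2 f0 raddf0.
have nv i m : m \in msupp (f i) -> m v = 0%N.
  by move=> mf; apply/eqP; rewrite cmE_eq0; apply: contra nUv; apply: (hf i).1.
have := congr1 (mcoeff (mmul m0 (powcm v i0))) P0.
rewrite mcoeff0 raddf_sum (bigD1 i0) //= [X in _ + X]big1 => [|i ni]; last first.
  rewrite raddf_sum big_seq big1 //= => m mf; rewrite mcoeffU.
  case: eqP => // /(congr1 (fun m : {cmonom V} => m v)); rewrite !cmM !powcmE.
  rewrite (nv _ _ mf) (nv _ _ m0f) !eqxx !muln1 => /ord_inj ei.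
  by rewrite ei eqxx in ni.
rewrite addr0 raddf_sum (big_fsetD1 m0) //= [X in X + _]mcoeffU eqxx.
rewrite big_seq big1 => [|m].
  by rewrite addr0 => /eqP; rewrite mcoeff_eq0 m0f.
rewrite in_fsetD1 => /andP[nm mf]; rewrite mcoeffU.
case: eqP => // em; case/eqP: nm; apply/eqP/cmP => w.
by have /(congr1 (fun m : {cmonom V} => m w)) := em; rewrite !cmM => /addIn.
Qed.

End Evaluation.

(** The base field L is the algebraic closure of F in E; along the enumeration
    of a, the successive closures stay inside the elements algebraic over the
    subrings generated by the initial segments of a. *)
Lemma alg_independent_free (F E : fieldType) (phi : {rmorphism F -> E}) r
    (a : 'I_r -> E) : alg_independent phi a ->
  exists L, [/\ rel_alg_closed L, forall c, phi c \in L & free_over L (codom a)].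
Proof.
move=> ind; pose M j := alg_over (eval_range phi a (fun i : 'I_r => i < j)%N).
have clM j : rel_alg_closed (M j) by apply/alg_over_subring/eval_range_subring.
have subM j : {subset eval_range phi a (fun i : 'I_r => i < j)%N <= M j}.
  exact/sub_alg_over/eval_range_subring.
exists (M 0%N); split=> // [c|]; first exact/subM/eval_range_const.
suff free j L : {subset L <= M j} -> free_over L (map a (drop j (enum 'I_r))).
  by have := free 0%N _ (fun _ zM => zM); rewrite drop0.
have [k] := ubnP (r - j)%N; elim: k j L => // k IH j L ltk sLM.
have [ltjr|lerj] := ltnP j r; last first.
  by rewrite drop_oversize ?size_enum_ord.
rewrite (drop_nth (Ordinal ltjr)) ?size_enum_ord //=; split.
  have jE : nat_of_ord (nth (Ordinal ltjr) (enum 'I_r) j) = j.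
    by rewrite nth_enum_ord.
  apply/negP => /sLM; apply/negP/transcendental_over_range; first exact: ind.
  by rewrite jE ltnn.
apply: IH; first by lia.
move=> z /adjoin_closedP; apply=> [|w /sLM|w]; first exact: clM.
  by apply/alg_overS/eval_rangeS => i; apply: ltnW.
rewrite inE => /eqP->; apply/subM/eval_range_var.
by rewrite nth_enum_ord.
Qed.

(** * Partial derivatives and simple roots *)

Section PartialDerivative.
Variables (F : fieldType) (V : choiceType).
Implicit Types (f g : {malg F[{cmonom V}]}) (m p : {cmonom V}) (v w : V).

Definition pderiv w f : {malg F[{cmonom V}]} :=
  \sum_(m <- msupp f) << f@_m *+ m w *g divcm m (ucm w) >>.

Lemma mulcmI w : injective (fun m => mmul m (ucm w)).
Proof.
move=> m1 m2 e; apply/eqP/cmP => v.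
by have := congr1 (fun m : {cmonom V} => m v) e; rewrite !cmM => /addIn.
Qed.

Lemma divcm_eq w m p : m w != 0%N ->
  (divcm m (ucm w) == p) = (m == mmul p (ucm w)).
Proof.
move=> mw; apply/eqP/eqP => [<-|->]; apply/eqP/cmP => v.
  rewrite cmM divcmE cmU; case: eqP => [<-|_]; last by rewrite subn0 addn0.
  by rewrite subnK // lt0n.
by rewrite divcmE cmM addnK.
Qed.

Lemma mcoeffE_sum f p : f@_p = \sum_(m <- msupp f) f@_m *+ (m == p).
Proof.
by rewrite {1}[f]monalgE raddf_sum /=; apply: eq_bigr => m _; rewrite mcoeffU.
Qed.

Lemma mcoeff_pderivE w f p : (pderiv w f)@_p =
  \sum_(m <- msupp f) f@_m *+ m w *+ (divcm m (ucm w) == p).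
Proof. by rewrite raddf_sum /=; apply: eq_bigr => m _; rewrite mcoeffU. Qed.

Lemma mcoeff_pderiv w f p :
  (pderiv w f)@_p = f@_(mmul p (ucm w)) *+ (p w).+1.
Proof.
rewrite mcoeff_pderivE (mcoeffE_sum f) -sumrMnl; apply: eq_bigr => m _.
have [m0|mw] := eqVneq (m w) 0%N; last first.
  rewrite divcm_eq //; case: eqP => [->|_]; last by rewrite !mulr0n mul0rn.
  by rewrite cmM cmUU addn1.
rewrite m0 mulr0n mul0rn; case: eqP => [em|_]; last by rewrite mul0rn.
by move: m0; rewrite em cmM cmUU addn1.
Qed.

Lemma msupp_pderiv w f p : p \in msupp (pderiv w f) -> mmul p (ucm w) \in msupp f.
Proof.
rewrite -!mcoeff_neq0 mcoeff_pderiv; apply: contraNneq => ->.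
by rewrite mul0rn.
Qed.

End PartialDerivative.

Section SimpleRoot.
Variables (F E : fieldType) (phi : {rmorphism F -> E}) (V : choiceType).
Variables (x : V -> E) (w : V).
Implicit Types (f : {malg F[{cmonom V}]}) (m : {cmonom V}).

Let rest m : E := \prod_(v <- finsupp m | v != w) x v ^+ m v.

Let evalE m : cmonom_eval x m = rest m * x w ^+ m w.
Proof.
rewrite /rest; have [wm|wm] := boolP (w \in finsupp m).
  by rewrite /cmonom_eval (bigD1_seq w) //= mulrC.
rewrite (eqP (_ : m w == 0%N)) ?cmE_eq0 // expr0 mulr1 /cmonom_eval.
rewrite big_seq [RHS]big_seq_cond; apply: eq_bigl => v.
by case: eqP => [->|_]; rewrite ?(negPf wm) ?andbT.
Qed.

Let eval_divcm m : m w != 0%N ->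
  cmonom_eval x (divcm m (ucm w)) = rest m * x w ^+ (m w).-1.
Proof.
move=> mw; have wm : w \in finsupp m by rewrite -cmE_neq0.
have le : (finsupp (divcm m (ucm w)) `<=` finsupp m)%fset.
  apply/fsubsetP => v; rewrite -!cmE_neq0 divcmE; apply: contraNneq => ->.
  by rewrite sub0n.
rewrite (cmonom_evalEw x le) (bigD1_seq w) //= divcmE cmUU subn1 mulrC.
congr (_ * _); apply: eq_bigr => v vw.
by rewrite divcmE cmU eq_sym (negPf vw) subn0.
Qed.

(** The univariate polynomial obtained from f by evaluating every indeterminate
    except w. *)
Definition slice f : {poly E} :=
  \sum_(m <- msupp f) (phi f@_m * rest m) *: 'X^(m w).

Lemma horner_slice f : (slice f).[x w] = poly_eval phi x f.
Proof.
rewrite /slice horner_sum poly_evalE; apply: eq_bigr => m _.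
by rewrite hornerZ hornerXn evalE mulrA.
Qed.

Lemma horner_deriv_slice f :
  (slice f)^`().[x w] = poly_eval phi x (pderiv w f).
Proof.
rewrite /slice /pderiv !raddf_sum horner_sum /=; apply: eq_bigr => m _.
rewrite [RHS]poly_evalU derivZ derivXn hornerZ hornerMn hornerXn.
have [m0|mw] := eqVneq (m w) 0%N; first by rewrite m0 !mulr0n rmorph0 mulr0 mul0r.
by rewrite eval_divcm // rmorphMn mulrnAl mulrnAr mulrA.
Qed.

(** The slice of f at w has x w as a root; it is nonzero because its derivative
    does not vanish at x w. *)
Lemma simple_root_closed L f : rel_alg_closed L -> (forall c, phi c \in L) ->
  (forall m v, m \in msupp f -> v \in finsupp m -> v != w -> x v \in L) ->
  poly_eval phi x f = 0 -> poly_eval phi x (pderiv w f) != 0 -> x w \in L.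
Proof.
move=> [hL aL] FL fL f0 pf0; apply: aL; apply/alg_overP; exists (slice f).
pose S : divringClosed E := HB.pack L (GRing.isDivringClosed.Build E L hL).
split; last by apply/rootP; rewrite horner_slice.
  apply/(@polyOverP _ S); rewrite /slice big_seq; apply: rpred_sum => m mf.
  apply: polyOverZ; last by rewrite rpredX // polyOverX.
  apply: rpredM; first exact: FL.
  rewrite /rest big_seq_cond; apply: rpred_prod => v /andP[vm vw].
  by apply: rpredX; apply: fL mf vm vw.
by apply: contraNneq pf0 => q0; rewrite -horner_deriv_slice q0 deriv0 horner0.
Qed.

End SimpleRoot.

(** * Derivatives of a differential polynomial, and separants *)

Section Prolongation.
Variables (F : fieldType) (delta : F -> F) (n : nat).
Implicit Types (f g : dpoly F n) (m p : {cmonom (theta n)}) (v w u : theta n).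

Lemma appearsP f v :
  reflect (exists2 m, m \in msupp f & v \in finsupp m) (appears f v).
Proof. exact: hasP. Qed.

Lemma leq_deg_in f v m : m \in msupp f -> (m v <= deg_in f v)%N.
Proof. by move=> mf; apply: leq_bigmax_seq. Qed.

Lemma dtheta_inj k : injective (@dtheta n k).
Proof. by move=> [i a] [j b] [-> /addnI ->]. Qed.

Lemma big_neq0 (I : eqType) (r : seq I) (R : zmodType) (G : I -> R) :
  \sum_(i <- r) G i != 0 -> exists2 i, i \in r & G i != 0.
Proof.
move=> s0; apply/hasP; apply: contraNT s0 => /hasPn h.
by rewrite big_seq big1 // => i /h; rewrite negbK => /eqP.
Qed.

Lemma mcoeff_deriv f p : (dpoly_deriv delta f)@_p =
  \sum_(m <- msupp f) (delta f@_m *+ (m == p) +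
    \sum_(v <- finsupp m) f@_m *+ m v *+
      (mmul (divcm m (ucm v)) (ucm (dtheta 1 v)) == p)).
Proof.
rewrite raddf_sum /=; apply: eq_bigr => m _; rewrite mcoeffD mcoeffU.
by congr (_ + _); rewrite raddf_sum /=; apply: eq_bigr => v _; rewrite mcoeffU.
Qed.

(** Each monomial of the derivative of f comes from a monomial of f, possibly
    with one factor u replaced by its derivative. *)
Lemma appears_deriv f v : appears (dpoly_deriv delta f) v ->
  appears f v \/ exists2 u, appears f u & v = dtheta 1 u.
Proof.
case/appearsP => p; rewrite -mcoeff_neq0 mcoeff_deriv => /big_neq0[m mf].
have [pm _ vp|_] := eqVneq m p.
  by left; apply/appearsP; exists m => //; rewrite pm.
rewrite mulr0n add0r => /big_neq0[u um].
case: (_ =P p) => [<- _|_]; last by rewrite mulr0n eqxx.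
rewrite -cmE_neq0 cmM divcmE !cmU addn_eq0 negb_and => /orP[h|].
  left; apply/appearsP; exists m => //; rewrite -cmE_neq0.
  by apply: contraNneq h => ->.
rewrite eqb0 negbK => /eqP <-; right; exists u => //.
by apply/appearsP; exists m.
Qed.

(** In a term f_m m(v) (m / v) v' of the derivative, w' can only be the new
    factor v', as it does not divide m; so the coefficient of w' collects exactly
    the terms with v = w. *)
Lemma pderiv_deriv f w : ~~ appears f (dtheta 1 w) ->
  pderiv (dtheta 1 w) (dpoly_deriv delta f) = pderiv w f.
Proof.
set w' := dtheta 1 w => nw'; apply/malgP => p.
have mw' m : m \in msupp f -> m w' = 0%N.
  move=> mf; apply/eqP; rewrite cmE_eq0; apply: contra nw' => h.
  by apply/appearsP; exists m.
have mp m : m \in msupp f -> (m == mmul p (ucm w')) = false.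
  by move=> mf; apply/eqP => e; have := mw' m mf; rewrite e cmM cmUU addn1.
have mvp m v : m \in msupp f ->
    (mmul (divcm m (ucm v)) (ucm (dtheta 1 v)) == mmul p (ucm w')) =
    (v == w) && (divcm m (ucm w) == p).
  move=> mf; have [->|vw] := eqVneq v w; first exact: (inj_eq (@mulcmI _ w')).
  apply/eqP => e; have := congr1 (fun m : {cmonom _} => m w') e.
  rewrite !cmM divcmE mw' // sub0n add0n cmUU addn1 cmU.
  by rewrite /w' (inj_eq (@dtheta_inj 1)) (negPf vw).
transitivity ((pderiv w f)@_p *+ (p w').+1).
  rewrite [LHS]mcoeff_pderiv [in LHS]mcoeff_deriv [in RHS]mcoeff_pderivE.
  congr (_ *+ _).
  rewrite big_seq [RHS]big_seq; apply: eq_bigr => m mf.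
  rewrite mp // mulr0n add0r; have [wm|wm] := boolP (w \in finsupp m).
    rewrite (bigD1_seq w) ?fset_uniq //= big1 ?addr0 => [|v vw].
      by rewrite mvp // eqxx.
    by rewrite mvp // (negPf vw) mulr0n.
  rewrite big_seq big1 => [|v vm].
    by rewrite (eqP (_ : m w == 0%N)) ?cmE_eq0 // mulr0n mul0rn.
  by rewrite mvp // (_ : v == w = false) ?mulr0n //; apply: contraNF wm => /eqP<-.
have [->|pw] := eqVneq (p w') 0%N; first by rewrite mulr1n.
rewrite mcoeff_pderiv mcoeff_outdom ?mul0rn //.
apply: contra nw' => h; apply/appearsP; exists (mmul p (ucm w)) => //.
by rewrite -cmE_neq0 cmM addn_eq0 negb_and pw.
Qed.

Section Ranking.
Variable (lt : rel (theta n)).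
Hypothesis hlt : ranking lt.

Lemma ranking_dtheta k v : (0 < k)%N -> lt v (dtheta k v).
Proof.
case: hlt => _ ltT _ ltD _; case: k => // k _.
elim: k => [|k IH]; first exact: ltD.
exact: ltT IH (ltD _).
Qed.

Lemma ranking_asym u v : lt u v -> ~~ lt v u.
Proof.
case: hlt => ltI ltT _ _ _ uv; apply/negP => vu.
by have := ltT _ _ _ uv vu; rewrite ltI.
Qed.

Definition prolong k f := iter k (dpoly_deriv delta) f.

Lemma appears_prolong f u k v : is_leader lt f u -> appears (prolong k f) v ->
  v != dtheta k u -> lt v (dtheta k u).
Proof.
move=> [uf uL]; have [_ ltT _ ltD ltM] := hlt.
elim: k v => [|k IH] v; first by case: u uf uL => j a uf uL; apply: uL.
move=> /appears_deriv[av|[w aw ->]] nv.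
  have [->|nk] := eqVneq v (dtheta k u); first exact: ltD.
  exact: ltT (IH v av nk) (ltD _).
by apply: (ltM w (dtheta k u)); apply: IH => //; apply: contraNneq nv => ->.
Qed.

(** All the derivatives of f are linear in their leaders from the first one on,
    with the separant of f as leading coefficient. *)
Lemma pderiv_prolong f u k : is_leader lt f u ->
  pderiv (dtheta k u) (prolong k f) = pderiv u f.
Proof.
move=> lu; have [ltI _ _ _ _] := hlt.
elim: k => [|k IH]; first by case: u lu.
apply: (etrans _ IH); apply: (@pderiv_deriv _ (dtheta k u)); apply/negP => a.
have ltk : lt (dtheta k u) (dtheta 1 (dtheta k u)) by exact: ranking_dtheta.
have [e|ne] := eqVneq (dtheta 1 (dtheta k u)) (dtheta k u).
  by rewrite e ltI in ltk.
by have := appears_prolong lu a ne; rewrite (negPf (ranking_asym ltk)).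
Qed.

Lemma prolong_order f k v : appears (prolong k f) v ->
  exists2 b, appears f (v.1, b) & (v.2 <= k + b)%N.
Proof.
elim: k v => [|k IH] v; first by move=> av; exists v.2; rewrite -?surjective_pairing.
move=> /appears_deriv[/IH[b ab le]|[w /IH[b ab le] ->]]; exists b => //=; lia.
Qed.

Lemma leader_unique f u v : is_leader lt f u -> is_leader lt f v -> u = v.
Proof.
move=> [uf uL] [vf vL]; apply/eqP/negPn/negP => nuv.
have := vL _ uf nuv; apply/negP/ranking_asym; apply: uL; rewrite // eq_sym //.
Qed.

(** The monomials of the separant divide those of f, so reducedness is inherited
    from f; with respect to f itself, the degree in u drops. *)
Lemma separant_reduced f g u : is_leader lt f u ->
  (f = g \/ reduced lt f g) -> reduced lt (pderiv u f) g.
Proof.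
move=> lu fg.
have sub m v : m \in msupp (pderiv u f) -> (m v <= (mmul m (ucm u)) v)%N.
  by move=> _; rewrite cmM leq_addr.
have app v : appears (pderiv u f) v -> appears f v.
  case/appearsP => m mS vm; apply/appearsP.
  exists (mmul m (ucm u)); first exact: msupp_pderiv.
  by rewrite mdomD inE vm.
have degS v : (deg_in (pderiv u f) v <= deg_in f v)%N.
  apply/bigmax_leqP_seq => m mS _; apply: leq_trans (sub _ v mS) _.
  exact/leq_deg_in/msupp_pderiv.
case: fg => [<-|[w lw [nd ld]]]; last first.
  exists w => //; split=> [k k0|]; first by apply: contra (nd k k0) => /app.
  exact: leq_ltn_trans (degS w) ld.
exists u => //; split=> [k k0|].
  apply/negP => /app a; have ltk := ranking_dtheta u k0.
  have [e|ne] := eqVneq (dtheta k u) u.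
    by case: hlt => ltI _ _ _ _; rewrite e ltI in ltk.
  by have := lu.2 _ a ne; rewrite (negPf (ranking_asym ltk)).
have [m mf um] := appearsP _ _ lu.1.
have : (0 < deg_in f u)%N.
  by apply: leq_trans (leq_deg_in u mf); rewrite lt0n cmE_neq0.
case: (deg_in f u) (@leq_deg_in f u) => // D hD _; rewrite ltnS.
apply/bigmax_leqP_seq => p pS _; have := hD _ (msupp_pderiv pS).
by rewrite cmM cmUU addn1.
Qed.

Lemma separant_neq0 (hF : [pchar F] =i pred0) f u :
  appears f u -> pderiv u f != 0.
Proof.
case/appearsP => m mf um; have mu : m u != 0%N by rewrite cmE_neq0.
have e : m = mmul (divcm m (ucm u)) (ucm u) by apply/eqP; rewrite -divcm_eq.
apply/eqP => /(congr1 (mcoeff (divcm m (ucm u)))); apply/eqP.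
rewrite mcoeff0 mcoeff_pderiv -e -mulr_natr mulf_neq0 ?mcoeff_neq0 //.
by rewrite (pcharf0P F).1.
Qed.

(** If two leaders were derivatives of the same indeterminate, one would be a
    derivative of the other; autoreducedness excludes proper derivatives, and
    equal leaders would have degrees less than each other. *)
Lemma leader_columns_inj r (A : 'I_r -> dpoly F n) (u : 'I_r -> theta n) :
  autoreduced lt A -> (forall i, is_leader lt (A i) (u i)) ->
  injective (fun i => (u i).1).
Proof.
move=> [_ red] lu.
suff wl i j : (u i).1 = (u j).1 -> ((u i).2 <= (u j).2)%N -> i = j.
  move=> i j eij; have [le|/ltnW le] := leqP (u i).2 (u j).2; first exact: wl.
  by apply/esym/wl.
move=> e le; apply/eqP/negPn/negP => nij.
have ej : u j = dtheta ((u j).2 - (u i).2) (u i).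
  by rewrite /dtheta subnK // e -surjective_pairing.
have [w lw [nd ld]] : reduced lt (A j) (A i) by apply: red; rewrite eq_sym.
rewrite {w lw}(leader_unique lw (lu i)) in nd ld.
have [k0|k0] := posnP ((u j).2 - (u i).2).
  have [w lw [_ ld']] : reduced lt (A i) (A j) by apply: red.
  rewrite {w lw}(leader_unique lw (lu j)) in ld'.
  move: ej ld'; rewrite k0 => ->; rewrite /dtheta add0n -surjective_pairing.
  by rewrite ltnNge (ltnW ld).
by have := nd _ k0; rewrite -ej (lu j).1.
Qed.

End Ranking.
End Prolongation.

(** * The transcendence degree of a window of derivatives *)

Section CharacteristicSets.
Variables (F : fieldType) (delta : F -> F) (n : nat).
Variables (lt : rel (theta n)) (I : {pred dpoly F n}).

Lemma separant_notin r (A : 'I_r -> dpoly F n) i u :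
  [pchar F] =i pred0 -> ranking lt -> characteristic_set lt I A ->
  is_leader lt (A i) u -> pderiv u (A i) \notin I.
Proof.
move=> hF hlt [[_ red] _ min] lu; apply/negP => SI.
have /negP := separant_neq0 hF lu.1; apply; apply/eqP/min => // j.
apply: separant_reduced => //.
by have [->|nij] := eqVneq i j; [left|right; apply: red].
Qed.

Lemma prolong_in k f : prime_diff_ideal delta I -> f \in I ->
  prolong delta k f \in I.
Proof. by case=> _ _ DI fI; elim: k => //= k; apply: DI. Qed.

End CharacteristicSets.

Lemma dord_natP (F : fieldType) n (f : dpoly F n) i :
  dord f i = -oo%E \/ exists o : nat, dord f i = o%:Z%:E.
Proof.
pose P (x : \bar int) := x = -oo%E \/ exists o : nat, x = o%:Z%:E.
have Pmax x y : P x -> P y -> P (Order.max x y).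
  by move=> Px Py; rewrite /Order.max; case: ifP.
apply: (big_ind P) => [|//|m _]; first by left.
by apply: (big_ind P) => [|//|v _]; [left|right; exists v.2].
Qed.

Lemma appears_le_dord (F : fieldType) n (f : dpoly F n) v :
  appears f v -> (v.2%:Z%:E <= dord f v.1)%E.
Proof.
case/appearsP => m mf vm; apply: le_trans (le_bigmax_seq _ m _ _ mf isT).
by apply: (le_bigmax_seq _ v (fun u : theta n => u.1 == v.1)).
Qed.

(** The order as a natural number, meaningful when it is not -oo. *)
Definition ord_nat (F : fieldType) n (f : dpoly F n) i : nat :=
  `|fine (dord f i)|%N.

Lemma dordE (F : fieldType) n (f : dpoly F n) i :
  dord f i != -oo%E -> dord f i = (ord_nat f i)%:Z%:E.
Proof.
by rewrite /ord_nat; case: (dord_natP f i) => [->|[o ->]]; rewrite ?eqxx.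
Qed.

Lemma appears_ord (F : fieldType) n (f : dpoly F n) v : appears f v ->
  dord f v.1 != -oo%E /\ (v.2 <= ord_nat f v.1)%N.
Proof.
move/appears_le_dord => h; have nN : dord f v.1 != -oo%E.
  by apply: contraTneq h => ->; rewrite -ltNge ltNyr.
by split=> //; move: h; rewrite (dordE nN) lee_fin lez_nat.
Qed.

Lemma Jac_ge (F : fieldType) n r (A : 'I_r -> dpoly F n) (s : 'I_r -> 'I_n) :
  injective s -> (forall i, dord (A i) (s i) != -oo%E) ->
  ((\sum_i ord_nat (A i) (s i))%:Z%:E <= Jac A)%E.
Proof.
move=> injs fin.
have -> : (\sum_i ord_nat (A i) (s i))%:Z%:E =
    (\sum_(i < r) dord (A i) ([ffun i => s i] i))%E.
  rewrite (big_morph Posz PoszD (erefl _)) -sumEFin.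
  by apply: eq_bigr => i _; rewrite ffunE dordE.
apply: le_bigmax_cond; apply/injectiveP => i j; rewrite !ffunE; exact: injs.
Qed.

Lemma ltn_count (T : eqType) (p q : pred T) (s : seq T) x :
  subpred p q -> x \in s -> q x -> ~~ p x -> (count p s < count q s)%N.
Proof.
move=> pq xs qx npx; have le : subpred (predU p (pred1 x)) q.
  by move=> y /orP[/pq//|/eqP->].
apply: leq_trans (sub_count le s); have := count_predUI p (pred1 x) s.
have -> : count (predI p (pred1 x)) s = 0%N.
  apply/eqP; rewrite -leqn0 leqNgt -has_count; apply/hasPn => y _ /=.
  by apply: contraNN npx => /andP[py /eqP <-].
have : (0 < count (pred1 x) s)%N by rewrite -has_count has_pred1.
lia.
Qed.

Section TriangularSystem.
Variables (F : fieldType) (delta : F -> F) (n r : nat).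
Variables (E : fieldType) (phi : {rmorphism F -> E}) (dE : E -> E).
Variables (eta : 'I_n -> E) (I : {pred dpoly F n}) (lt : rel (theta n)).
Variables (A : 'I_r -> dpoly F n) (u : 'I_r -> theta n).
Hypotheses (hF : [pchar F] =i pred0) (hI : prime_diff_ideal delta I).
Hypotheses (heta : generic_point phi dE I eta) (hlt : ranking lt).
Hypotheses (hA : characteristic_set lt I A).
Hypothesis hu : forall i, is_leader lt (A i) (u i).
Variables (M : 'I_r -> nat) (N : 'I_n -> nat).
Hypothesis hMN : potential (fun i j => dord (A i) j != -oo%E)
  (fun i j => ord_nat (A i) j) M N.

Let value (v : theta n) : E := iter v.2 dE (eta v.1).

Definition window : seq (theta n) :=
  [seq (j, k) | j <- enum 'I_n, k <- iota 0 (N j)].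

(** The leaders of the derivatives A_i^(k) with k < M_i. *)
Definition principal : seq (theta n) :=
  [seq dtheta k (u i) | i <- enum 'I_r, k <- iota 0 (M i)].

Lemma mem_window v : (v \in window) = (v.2 < N v.1)%N.
Proof.
apply/allpairsPdep/idP => [[j [k [_ + ->]]]|vN]; first by rewrite mem_iota.
by exists v.1, v.2; rewrite mem_enum mem_iota add0n vN -surjective_pairing.
Qed.

Lemma principalP v :
  reflect (exists i k, (k < M i)%N /\ v = dtheta k (u i)) (v \in principal).
Proof.
apply: (iffP idP) => [/allpairsPdep[i [k [_ + ->]]]|[i [k [kM ->]]]].
  by rewrite mem_iota => /= kM; exists i, k.
by apply/allpairsPdep; exists i, k; rewrite mem_enum mem_iota.
Qed.

Lemma uniq_window : uniq window.
Proof.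
apply: allpairs_uniq_dep => [|j _|]; [exact: enum_uniq|exact: iota_uniq|].
by move=> [j k] [j' k'] _ _ [-> ->].
Qed.

Lemma uniq_principal : uniq principal.
Proof.
apply: allpairs_uniq_dep => [|j _|]; [exact: enum_uniq|exact: iota_uniq|].
have [red _ _] := hA; move=> [i k] [i' k'] _ _ /= e.
have ei : i = i' by apply: (leader_columns_inj hlt red hu); case: e.
by move: e; rewrite -ei => -[/addIn->].
Qed.

Lemma size_window : size window = (\sum_j N j)%N.
Proof.
rewrite size_allpairs_dep sumnE big_map big_enum /=.
by apply: eq_bigr => j _; rewrite size_iota.
Qed.

Lemma size_principal : size principal = (\sum_i M i)%N.
Proof.
rewrite size_allpairs_dep sumnE big_map big_enum /=.
by apply: eq_bigr => j _; rewrite size_iota.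
Qed.

Lemma prolong_window i k v : (k < M i)%N ->
  appears (prolong delta k (A i)) v -> v \in window.
Proof.
move=> kM /prolong_order[b /appears_ord[fin /= le] le'].
by rewrite mem_window; have := hMN fin; rewrite /=; lia.
Qed.

Lemma principal_window : {subset principal <= window}.
Proof.
move=> v /principalP[i [k [kM ->]]].
have [fin le] := appears_ord (hu i).1.
by rewrite mem_window /=; have := hMN fin; lia.
Qed.

Definition parametric := [seq v <- window | v \notin principal].

Lemma size_parametric : (size parametric + \sum_i M i = \sum_j N j)%N.
Proof.
rewrite -size_window -size_principal addnC -(count_predC (mem principal) window).
rewrite -!size_filter; congr (_ + _)%N; apply/perm_size/uniq_perm.
- exact: uniq_principal.
- exact/filter_uniq/uniq_window.
move=> v; rewrite mem_filter /=; apply/idP/andP => [vp|[]//].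
by split=> //; apply: principal_window.
Qed.

(** Induction on the number of derivatives of the window below v: a leader v of
    A_i^(k) is a simple root of A_i^(k), whose other derivatives lie in the
    window, below v. *)
Lemma window_algebraic L : rel_alg_closed L -> (forall c, phi c \in L) ->
  {subset map value parametric <= L} -> forall v, v \in window -> value v \in L.
Proof.
move=> hL FL pL v; have [k] := ubnP (count (fun w => lt w v) window).
elim: k v => // k IH v ltk vW.
have [/principalP[i [l [lM ev]]]|np] := boolP (v \in principal); last first.
  by apply: pL; apply/map_f; rewrite mem_filter np.
apply: (simple_root_closed (phi := phi) (x := value)
  (f := prolong delta l (A i)) hL FL).
- move=> m w mf wm nwv.
  have aw : appears (prolong delta l (A i)) w by apply/appearsP; exists m.
  have wv : lt w v by rewrite ev; apply: appears_prolong aw _; rewrite -?ev.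
  have wW := prolong_window lM aw; apply: IH => //.
  rewrite -ltnS; apply: leq_trans ltk; rewrite ltnS.
  have [ltI ltT _ _ _] := hlt.
  apply: (@ltn_count _ _ _ _ w) => // [z zw|]; first exact: ltT zw wv.
  by rewrite ltI.
- by apply/heta/prolong_in => //; case: hA => _ h _.
- rewrite ev (pderiv_prolong delta hlt _ (hu i)); apply/eqP => /heta.
  by apply/negP; apply: separant_notin hF hlt hA (hu i).
Qed.

(** The inequality (2), for independent families inside the field generated by
    the derivatives of order at most t. *)
Lemma independent_leq t q (a : 'I_q -> E) :
  (forall j, (t < N j)%N) ->
  (forall i, adjoin phi (derivatives_upto dE eta t) (a i)) ->
  alg_independent phi a -> (q + \sum_i M i <= \sum_j N j)%N.
Proof.
move=> tN aK /alg_independent_free[L [hL FL fr]].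
rewrite -size_parametric leq_add2r -(size_map value).
have -> : q = size (codom a) by rewrite size_codom card_ord.
apply: steinitz hL fr _ => _ /codomP[i ->].
apply/adjoin_closedP => K hK LK pK; apply: aK.
  by split; [exact: hK.1|move=> c; apply/LK/FL].
move=> _ [j [k [kt ->]]].
apply: (window_algebraic hK _ pK (v := (j, k))); first by move=> c; apply/LK/FL.
by rewrite mem_window (leq_ltn_trans kt).
Qed.

End TriangularSystem.

Theorem theorem23 (F : fieldType) (delta : F -> F)
    (hF : [pchar F] =i pred0) (hdelta : derivation delta)
    (n : nat) (I : {pred dpoly F n}) (hI : prime_diff_ideal delta I)
    (E : fieldType) (phi : {rmorphism F -> E}) (dE : E -> E)
    (hE : diff_extension phi delta dE)
    (eta : 'I_n -> E) (heta : generic_point phi dE I eta)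
    (d : nat) (hd : diff_dim phi dE eta d)
    (h : nat) (hh : diff_order phi dE eta d h)
    (lt : rel (theta n)) (hlt : ranking lt)
    (A : 'I_(n - d) -> dpoly F n) (hA : characteristic_set lt I A) :
  (h%:Z%:E <= Jac A)%E.
Proof.
have [red _ _] := hA; have [u hu] := choice red.1.
have [t0 tr] := hh.
(* the matrix of orders; e marks its finite entries, among them those at the
   leaders, which form an injective assignment *)
pose e i j := dord (A i) j != -oo%E; pose c i j := ord_nat (A i) j.
have eu i : e i (u i).1 by have [] := appears_ord (hu i).1.
have [[|t] [M [N [s [// tT TN pMN [injs es] sN]]]]] :=
  assignment_duality c t0.+1 (leader_columns_inj hlt red hu) eu.
have [[a aK ind] _] := tr t tT.
have := independent_leq hF hI heta hlt hA hu pMN TN aK ind.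
have : ((n - (n - d)) * t.+1 <= d * t.+1)%N by apply: leq_mul; lia.
move=> le1 le2; apply: le_trans (Jac_ge injs es).
by rewrite lee_fin lez_nat; move: sN le1 le2; rewrite /c; lia.
Qed.
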